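(* Let $\mathcal M$ be the (finitely branching, countable) MDP with states $s_0,r_1,r_2,r_3,\dots$, all of them controlled, and with the following transitions and rational rewards: $s_0\to r_1$ with reward $-1$; and for every $i\ge 1$, $r_i\to r_{i+1}$ with reward $-1$ and $r_i\to s_0$ with reward $-\frac1i$. Let $\varphi$ be the event that the $\limsup$ of the sequence of transition rewards seen along the run is $\ge 0$. Then: (1) there exists a strategy $\hat\sigma$ with $\mathcal P_{\mathcal M,s_0,\hat\sigma}(\varphi)=1$, i.e. the state $s_0$ is almost surely winning for $\varphi$; (2) for every deterministic finite-memory strategy $\sigma$ we have $\mathcal P_{\mathcal M,s_0,\sigma}(\varphi)=0$. So almost surely winning strategies for this objective, when they exist, cannot in general be chosen deterministic with finite memory.
   Context: In an MDP with only controlled states, a run is an infinite path in the transition graph, a history is a finite path, and a strategy $\sigma$ maps each history ending in a state $s$ to a probability distribution on the set of successors of $s$; it induces a probability measure $\mathcal P_{\mathcal M,s_0,\sigma}$ on runs from $s_0$. A deterministic finite-memory strategy is given by a finite set $\mathsf M$ of memory modes, an initial mode, a function choosing (deterministically) a successor of the current state from the current state and the current mode, and a function choosing (deterministically) the next mode from the current mode, the current state and the next state. *)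

(* Defs.v *)
From HB Require Import structures.
From mathcomp Require Import all_boot all_order all_algebra.
From mathcomp Require Import all_classical all_reals all_analysis.
From mathcomp Require Import measurable_realfun.

Set Implicit Arguments.
Unset Strict Implicit.
Unset Printing Implicit Defensive.
Import Order.TTheory GRing.Theory Num.Theory.

Local Open Scope classical_set_scope.
Local Open Scope ring_scope.

(* A countable MDP all of whose states are controlled. Rewards label
   transitions: the value [reward s t] only matters when [trans s t]. *)
Record mdp := MDP {
  state :> countType;
  trans : rel state;
  reward : state -> state -> rat;
  trans_total : forall s : state, exists t, trans s t }.

Definition finitely_branching (M : mdp) :=
  forall s : M, finite_set [set t | trans s t].

(* A history is a nonempty finite path, given by its first state and the list
   of the subsequent ones. *)
Definition history (M : mdp) :=
  {h : M * seq M | path (@trans M) h.1 h.2}.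

Definition hist_last (M : mdp) (h : history M) : M :=
  last (val h).1 (val h).2.

Definition hist_length (M : mdp) (h : history M) : nat := size (val h).2.

(* Probability distributions on a subset [A] of a countable type. *)
Record distr (R : realType) (T : countType) (A : pred T) := Distr {
  pmf :> T -> R;
  pmf_ge0 : forall t, 0 <= pmf t;
  pmf_out : forall t, ~~ A t -> pmf t = 0;
  pmf_sum1 : (\esum_(t in [set: T]) (pmf t)%:E = 1)%E }.

Definition strategy (R : realType) (M : mdp) :=
  forall h : history M, distr R (trans (hist_last h)).

Record run (M : mdp) (s : M) := Run {
  run_at :> nat -> M;
  run_start : run_at 0%N = s;
  run_trans : forall n, trans (run_at n) (run_at n.+1) }.

Section run_space.
Variables (M : mdp) (s : M).
Implicit Types w : run s.

Lemma run_eqP w w' : (forall n, w n = w' n) -> w = w'.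
Proof.
case: w w' => [f f0 fS] [g g0 gS] /= /funext fg; subst g.
by congr Run; exact: Prop_irrelevance.
Qed.

Lemma run_prefix_path w n :
  path (@trans M) (w 0%N) (mkseq (fun i => w i.+1) n).
Proof.
apply/(pathP (w 0%N)) => i; rewrite size_mkseq => ilt.
rewrite nth_mkseq//; case: i ilt => [|i] ilt /=; first exact: run_trans.
by rewrite nth_mkseq ?run_trans// ltnW.
Qed.

Definition run_prefix w n : history M :=
  exist _ (w 0%N, mkseq (fun i => w i.+1) n) (run_prefix_path w n).

Definition cylinder (h : history M) : set (run s) :=
  [set w | run_prefix w (hist_length h) = h].

HB.instance Definition _ := gen_eqMixin (run s).
HB.instance Definition _ := gen_choiceMixin (run s).

Definition default_succ (t : M) : {t' : M | trans t t'} := cid (trans_total t).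

Lemma default_run_trans n :
  trans (iter n (fun t => sval (default_succ t)) s)
        (iter n.+1 (fun t => sval (default_succ t)) s).
Proof. exact: (svalP (default_succ _)). Qed.

Definition default_run : run s := Run erefl default_run_trans.

(* Measurable types are pointed in the library. *)
HB.instance Definition _ := isPointed.Build (run s) default_run.

(* The runs from [s], with the sigma-algebra generated by the cylinders. *)
Definition runs := g_sigma_algebraType (range cylinder).

End run_space.

(* [P] gives the cylinder of each finite path from [s] the product of the
   probabilities with which [sigma] takes its transitions. *)
Definition induced_by (R : realType) (M : mdp) (sigma : strategy R M) (s : M)
    (P : probability (runs s) R) :=
  forall (w : run s) (n : nat),
    P (cylinder (run_prefix w n)) =
    (\prod_(i < n) sigma (run_prefix w i) (w i.+1))%:E.

(* Existence and uniqueness of the induced measure; existence is by sampling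
   the successors from a uniform random variable on [0, 1). *)
Section unit_interval.
Variable R : realType.

Let mD : measurable (`[0, 1[%classic : set (measurableTypeR R)).
Proof. exact: measurable_itv. Qed.

Definition unit_prob : set (measurableTypeR R) -> \bar R :=
  mrestr lebesgue_measure mD.

HB.instance Definition _ := Measure.copy unit_prob (mrestr lebesgue_measure mD).

Let unit_probT : unit_prob setT = 1%E.
Proof.
by rewrite /unit_prob /mrestr setTI lebesgue_measure_itv/= lte_fin ltr01 sube0.
Qed.

HB.instance Definition _ :=
  Measure_isProbability.Build _ _ _ unit_prob unit_probT.

End unit_interval.

Section run_probability_exists.
Variables (R : realType) (M : mdp) (sigma : strategy R M) (s : M).
Implicit Types (h : history M) (t : M) (u : R).

Lemma prefix_ext (w w' : run s) n :
  (forall i, (i < n)%N -> w i.+1 = w' i.+1) -> run_prefix w n = run_prefix w' n.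
Proof.
move=> E; apply: val_inj => /=; rewrite !run_start; congr pair.
by apply/eq_in_map => i; rewrite mem_iota add0n => /E.
Qed.

Lemma prefixS (w w' : run s) n : run_prefix w n.+1 = run_prefix w' n.+1 <->
  run_prefix w n = run_prefix w' n /\ w n.+1 = w' n.+1.
Proof.
split=> [/(congr1 (fun h => (val h).2)) E|[/(congr1 (fun h => (val h).2)) E e]].
  move: E; rewrite [LHS]/= [RHS]/= => E; have nthE i : (i <= n)%N -> w i.+1 = w' i.+1.
    move=> lin; have := congr1 (fun x => nth s x i) E.
    by rewrite !nth_mkseq.
  split; last exact: nthE.
  by apply: prefix_ext => i /ltnW; exact: nthE.
apply: val_inj; rewrite [LHS]/= [RHS]/= !run_start !mkseqS e.
by congr (_, rcons _ _); exact: E.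
Qed.

Lemma prefix_le (w w' : run s) m n : (m <= n)%N ->
  run_prefix w n = run_prefix w' n -> run_prefix w m = run_prefix w' m.
Proof.
move=> /subnKC <-; elim: (n - m)%N => [|k IH]; first by rewrite addn0.
by rewrite addnS => /prefixS[/IH].
Qed.

Lemma cylinderP (w w' : run s) n :
  cylinder (run_prefix w n) w' <-> run_prefix w' n = run_prefix w n.
Proof. by rewrite /cylinder /= /hist_length size_mkseq. Qed.

Lemma hist_last_run_prefix (w : run s) n : hist_last (run_prefix w n) = w n.
Proof.
rewrite -[LHS]/(last (w 0%N) (mkseq (fun i => w i.+1) n)).
by case: n => // n; rewrite mkseqS last_rcons.
Qed.

(* The unit interval is cut into consecutive slots, one for each state code. *)
Let slot h (k : nat) : R := if pickle_inv k is Some t then sigma h t else 0.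
Let cum h (k : nat) : R := \sum_(i < k) slot h i.

Lemma slot_ge0 h k : 0 <= slot h k.
Proof. by rewrite /slot; case: pickle_inv => // t; exact: pmf_ge0. Qed.

Lemma slot_pickle h t : slot h (pickle t) = sigma h t.
Proof. by rewrite /slot pickleK_inv. Qed.

Lemma cumS h k : cum h k.+1 = cum h k + slot h k.
Proof. by rewrite /cum big_ord_recr. Qed.

Lemma cum_ge0 h k : 0 <= cum h k.
Proof. by apply: sumr_ge0 => i _; exact: slot_ge0. Qed.

Lemma cum_le h k l : (k <= l)%N -> cum h k <= cum h l.
Proof.
move=> /subnKC <-; elim: (l - k)%N => [|m IH]; first by rewrite addn0.
by rewrite addnS cumS (le_trans IH)// lerDl slot_ge0.
Qed.

Lemma slot_sum1 h : (\sum_(k <oo) (slot h k)%:E = 1)%E.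
Proof.
rewrite nneseries_esumT; last by move=> k; rewrite lee_fin slot_ge0.
rewrite -(pmf_sum1 (sigma h)).
transitivity (\esum_(k in pickle @` [set: M]) (slot h k)%:E)%E.
  rewrite [RHS]esum_mkcond; apply: eq_esum => k _.
  case: ifPn => //; rewrite notin_setE => nk; rewrite /slot.
  case E: (pickle_inv k) => [t|]//; exfalso; apply: nk; exists t => //.
  by have := @pickle_invK M k; rewrite E.
rewrite esum_image; last by move=> x y _ _; exact: (pcan_inj (@pickleK_inv M)).
by apply: eq_esum => t _; rewrite slot_pickle.
Qed.

Lemma cum_le1 h k : cum h k <= 1.
Proof.
rewrite -lee_fin -(slot_sum1 h) /cum -sumEFin.
rewrite -(big_mkord xpredT (fun i => (slot h i)%:E)).
by apply: nneseries_lim_ge => i _; rewrite lee_fin slot_ge0.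
Qed.

Lemma cum_gt h u : u < 1 -> exists k, u < cum h k.
Proof.
move=> u1; apply: contrapT => /forallNP H.
suff: (\sum_(k <oo) (slot h k)%:E <= u%:E)%E by rewrite slot_sum1 lee_fin leNgt u1.
apply: lime_le.
  by apply: is_cvg_nneseries => i _ _; rewrite lee_fin slot_ge0.
apply: nearW => n; rewrite big_mkord sumEFin lee_fin leNgt.
by apply/negP => un; exact: (H n).
Qed.

Let in_slot h t u := cum h (pickle t) <= u < cum h (pickle t) + sigma h t.

Lemma in_slot_exists h u : 0 <= u < 1 -> exists t, in_slot h t u.
Proof.
case/andP=> u0 /(cum_gt h) ex; case: (ex_minnP ex) => -[|k] uk kmin.
  by move: uk; rewrite /cum big_ord0 ltNge u0.
have ku : cum h k <= u by rewrite leNgt; apply/negP => /kmin; rewrite ltnn.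
move: uk; rewrite cumS; have := @pickle_invK M k.
rewrite /slot; case: pickle_inv => [t /= Ek uk|_]; last by rewrite addr0 ltNge ku.
by exists t; rewrite /in_slot Ek ku.
Qed.

Lemma in_slot_inj h t t' u : in_slot h t u -> in_slot h t' u -> t = t'.
Proof.
move=> /andP[a b] /andP[c d]; apply: (pcan_inj (@pickleK_inv M)).
have aux (x y : M) : cum h (pickle x) <= u -> u < cum h (pickle y) + sigma h y ->
    (pickle x <= pickle y)%N.
  move=> ux uy; rewrite leqNgt; apply/negP => /(cum_le h).
  by rewrite cumS slot_pickle => /(lt_le_trans uy); rewrite ltNge ux.
by apply/eqP; rewrite eqn_leq (aux t t')// (aux t' t).
Qed.

Lemma in_slot_trans h t u : in_slot h t u -> trans (hist_last h) t.
Proof.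
move=> /andP[a b]; apply/negPn/negP => /(pmf_out (sigma h)) e.
by move: b; rewrite e addr0 ltNge a.
Qed.

(* Rescaled slots inside an interval with left end [a] and length [b]. *)
Let in_sub h (a b : R) t u :=
  a + b * cum h (pickle t) <= u < a + b * cum h (pickle t) + b * sigma h t.

Let in_subE h a b t u : 0 < b -> in_sub h a b t u = in_slot h t ((u - a) / b).
Proof.
move=> b0; rewrite /in_sub /in_slot -addrA -mulrDr.
by rewrite ler_pdivlMr// ltr_pdivrMr// lerBrDl ltrBlDl ![_ * b]mulrC.
Qed.

Lemma next_exists h a b u :
  exists t, trans (hist_last h) t /\ (a <= u < a + b -> in_sub h a b t u).
Proof.
have [/andP[au ub]|nu] := boolP (a <= u < a + b); last first.
  by have [t ht] := trans_total (hist_last h); exists t.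
have b0 : 0 < b by rewrite -(ltrDl a) (le_lt_trans au).
have [|t ht] := @in_slot_exists h ((u - a) / b).
  by rewrite divr_ge0 ?(ltW b0) ?subr_ge0//= ltr_pdivrMr// mul1r ltrBlDl.
exists t; split; first exact: in_slot_trans ht.
by move=> _; rewrite in_subE.
Qed.

Lemma snoc_path h t : trans (hist_last h) t ->
  path (@trans M) (val h).1 (rcons (val h).2 t).
Proof. by move=> e; rewrite rcons_path e (valP h). Qed.

Let snoc h t (e : trans (hist_last h) t) : history M :=
  exist (fun h : M * seq M => is_true (path (@trans M) h.1 h.2))
    ((val h).1, rcons (val h).2 t) (snoc_path e).

Let nextt u (x : history M * (R * R)) : M := sval (cid (next_exists x.1 x.2.1 x.2.2 u)).
Let nextP u x : trans (hist_last x.1) (nextt u x) /\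
  (x.2.1 <= u < x.2.1 + x.2.2 -> in_sub x.1 x.2.1 x.2.2 (nextt u x) u) :=
  svalP (cid (next_exists x.1 x.2.1 x.2.2 u)).

Let step u (x : history M * (R * R)) : history M * (R * R) :=
  (snoc (nextP u x).1,
   (x.2.1 + x.2.2 * cum x.1 (pickle (nextt u x)), x.2.2 * sigma x.1 (nextt u x))).

Let init : history M * (R * R) :=
  (exist (fun h : M * seq M => is_true (path (@trans M) h.1 h.2)) (s, [::]) isT,
   (0, 1)).
Let Z u n := iter n (step u) init.

Let ZS u n : Z u n.+1 = step u (Z u n). Proof. by []. Qed.

Lemma sample_trans u n : trans (hist_last (Z u n).1) (hist_last (Z u n.+1).1).
Proof.
rewrite ZS; set x := Z u n.
have -> : hist_last (step u x).1 = nextt u x by rewrite /hist_last /= last_rcons.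
exact: (nextP u x).1.
Qed.

Let X u : run s := Run (erefl : hist_last (Z u 0).1 = s) (sample_trans u).

Let XS u n : X u n.+1 = nextt u (Z u n).
Proof.
rewrite /X; cbn [run_at]; rewrite ZS /hist_last /=.
by rewrite last_rcons.
Qed.

Lemma prefix_sample u n : run_prefix (X u) n = (Z u n).1.
Proof.
elim: n => [|n IH]; first exact: val_inj.
apply: val_inj.
transitivity ((val (run_prefix (X u) n)).1,
    rcons (val (run_prefix (X u) n)).2 (X u n.+1)).
  by rewrite [LHS]/= mkseqS.
by rewrite IH XS.
Qed.

Let B (w : run s) n := \prod_(i < n) sigma (run_prefix w i) (w i.+1).
Let A (w : run s) n : R :=
  \sum_(i < n) B w i * cum (run_prefix w i) (pickle (w i.+1)).

Let A0 w : A w 0 = 0. Proof. by rewrite /A big_ord0. Qed.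
Let B0 w : B w 0 = 1. Proof. by rewrite /B big_ord0. Qed.
Let AS w n : A w n.+1 = A w n + B w n * cum (run_prefix w n) (pickle (w n.+1)).
Proof. by rewrite /A big_ord_recr. Qed.
Let BS w n : B w n.+1 = B w n * sigma (run_prefix w n) (w n.+1).
Proof. by rewrite /B big_ord_recr. Qed.

Lemma AB_sub w n : 0 <= B w n ->
  A w n <= A w n.+1 /\ A w n.+1 + B w n.+1 <= A w n + B w n.
Proof.
move=> b; rewrite AS BS; split; first by rewrite lerDl mulr_ge0// cum_ge0.
by rewrite -addrA -mulrDr -slot_pickle -cumS lerD2l ler_piMr// cum_le1.
Qed.

Lemma AB_ge0 w n : [/\ 0 <= A w n, 0 <= B w n & A w n + B w n <= 1].
Proof.
elim: n => [|n [a b ab]]; first by rewrite A0 B0 add0r.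
have [l r] := AB_sub b.
split; [exact: le_trans l| |exact: le_trans r ab].
by rewrite BS mulr_ge0// pmf_ge0.
Qed.

Lemma AB_prefix w w' n : run_prefix w n = run_prefix w' n ->
  A w n = A w' n /\ B w n = B w' n.
Proof.
elim: n => [|n IH]; first by rewrite !A0 !B0.
move=> /prefixS[e1 e2]; have [eA eB] := IH e1.
by rewrite !AS !BS eA eB e1 e2.
Qed.

Lemma ZE u n : (Z u n).2 = (A (X u) n, B (X u) n).
Proof.
elim: n => [|n IH]; first by rewrite A0 B0.
by rewrite ZS AS BS [LHS]/= IH prefix_sample XS.
Qed.

Lemma sample_in u n : 0 <= u < 1 -> A (X u) n <= u < A (X u) n + B (X u) n.
Proof.
move=> u01; elim: n => [|n IH]; first by rewrite A0 B0 add0r.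
have := (nextP u (Z u n)).2; rewrite -XS ZE -prefix_sample => /(_ IH).
by rewrite /in_sub AS BS.
Qed.

Lemma sample_prefix (w : run s) u n : 0 <= u < 1 ->
  run_prefix (X u) n = run_prefix w n <-> A w n <= u < A w n + B w n.
Proof.
move=> u01; split=> [/AB_prefix[<- <-]|]; first exact: sample_in.
elim: n => [_|n IH H]; first exact: prefix_ext.
have [a b ab] := AB_ge0 w n.
have b0 : 0 < B w n.
  rewrite lt_neqAle b andbT; apply/eqP => e.
  move: H; rewrite AS BS -e !mul0r !addr0 => /andP[H1 H2].
  by have := le_lt_trans H1 H2; rewrite ltxx.
have Hn : A w n <= u < A w n + B w n.
  have [l r] := AB_sub b; case/andP: H => H1 H2.
  by rewrite (le_trans l H1) (lt_le_trans H2 r).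
have e := IH Hn; apply/prefixS; split=> //.
have [eA eB] := AB_prefix e.
have := sample_in n.+1 u01; rewrite AS BS e eA eB => H'.
apply: (@in_slot_inj (run_prefix w n) _ _ ((u - A w n) / B w n)).
- by rewrite -in_subE.
- by rewrite -in_subE// /in_sub -AS -BS.
Qed.

Let D : set R := `[0, 1[%classic.
Let Y (u : measurableTypeR R) : runs s := if 0 <= u < 1 then X u else default_run s.

Lemma sample_cylinder (w : run s) n :
  Y @^-1` cylinder (run_prefix w n) `&` D = `[A w n, A w n + B w n[%classic.
Proof.
have hl : hist_length (run_prefix w n) = n by rewrite /hist_length size_mkseq.
have [a b ab] := AB_ge0 w n.
apply/seteqP; split => u; rewrite /D /Y /= !in_itv /= /cylinder /= hl.
  by case=> + u01; rewrite u01 => /(sample_prefix _ _ u01).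
move=> H; have u01 : 0 <= u < 1.
  by case/andP: H => H1 H2; rewrite (le_trans a H1) (lt_le_trans H2 ab).
by rewrite u01; split=> //; apply/sample_prefix.
Qed.

Lemma cylinder_nonempty (h : history M) (w : run s) :
  cylinder h w -> cylinder (s := s) h = cylinder (run_prefix w (hist_length h)).
Proof. by move=> ->. Qed.

Lemma measurable_sample : measurable_fun setT Y.
Proof.
refine (@measurability _ _ _ _ setT Y (range (@cylinder M s)) erefl _).
move=> _ [_ [h _ <-] <-].
rewrite setTI; have [->|/set0P[w hw]] := eqVneq (cylinder (s := s) h) set0.
  by rewrite preimage_set0.
rewrite (cylinder_nonempty hw); set C := cylinder _.
rewrite -(setIT (Y @^-1` C)) -(setUv D) setIUr; apply: measurableU.
  by rewrite sample_cylinder; exact: measurable_itv.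
have mDc : measurable (~` D) by apply: measurableC; exact: measurable_itv.
have YD u : (~` D) u -> Y u = default_run s.
  by rewrite /D /Y /= in_itv/= => /negP/negbTE ->.
have [dC|dC] := pselect (C (default_run s)).
  rewrite (_ : _ `&` _ = ~` D)//; apply/seteqP; split=> u; first by case.
  by move=> uD; split=> //; rewrite /preimage /= YD.
rewrite (_ : _ `&` _ = set0)//; apply/seteqP; split=> u // [+ uD].
by rewrite /preimage /= YD.
Qed.

Lemma induced_exists : exists P : probability (runs s) R, induced_by sigma P.
Proof.
pose mixY := isMeasurableFun.Build _ _ _ _ Y measurable_sample.
pose mY : {mfun measurableTypeR R >-> runs s} := HB.pack Y mixY.
exists (distribution (@unit_prob R) mY) => w n.
transitivity (lebesgue_measure `[A w n, A w n + B w n[%classic).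
  by rewrite -sample_cylinder.
have [a b ab] := AB_ge0 w n.
rewrite lebesgue_measure_itv/= lte_fin ltrDl -/(B w n).
case: ltgtP b => // [_|<-] _; last by [].
by rewrite -EFinB addrC addKr.
Qed.

Lemma induced_unique (P Q : probability (runs s) R) :
  induced_by sigma P -> induced_by sigma Q ->
  forall E, measurable E -> P E = Q E.
Proof.
move=> hP hQ; set G := [set set0] `|` range (@cylinder M s).
have GE : G = [set C | C = set0 \/ exists (w : run s) n, C = cylinder (run_prefix w n)].
  apply/seteqP; split=> [C [->|[h _ <-]]|C [->|[w [n ->]]]]; [by left| |by left|].
  - have [->|/set0P[w hw]] := eqVneq (cylinder (s := s) h) set0; [by left|right].
    by exists w, (hist_length h); exact: cylinder_nonempty.
  - by right; exists (run_prefix w n).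
refine (@measure_unique _ R (runs s) G (fun=> setT) _ _ _ _ P Q _ _).
- rewrite /G; apply/seteqP; split.
    apply: smallest_sub; first exact: smallest_sigma_algebra.
    by move=> C hC; apply: sub_sigma_algebra; right.
  apply: smallest_sub; first exact: smallest_sigma_algebra.
  move=> C [->|hC]; first exact: sigma_algebra0.
  exact: sub_sigma_algebra.
- rewrite GE => C C' [->|[w [n ->]]]; first by rewrite set0I; left.
  case=> [->|[w' [n' ->]]]; first by rewrite setI0; left.
  have capE (v v' : run s) m m' : (m <= m')%N ->
      G (cylinder (run_prefix v m) `&` cylinder (run_prefix v' m')).
    move=> mm'; have [e|ne] := pselect (run_prefix v' m = run_prefix v m).
      rewrite GE; right; exists v', m'; apply/seteqP; split=> [x []//|x xv'].
      split=> //; rewrite -e; apply/cylinderP.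
      by apply: prefix_le mm' _; exact/cylinderP.
    rewrite GE; left; apply/seteqP; split=> // x [/cylinderP xv /cylinderP xv'].
    by apply: ne; rewrite -xv; apply/esym/(prefix_le mm').
  have [nn'|/ltnW nn'] := leqP n n'; rewrite -GE; first exact: capE.
  by rewrite setIC; exact: capE.
- move=> _; rewrite GE; right; exists (default_run s), 0.
  apply/seteqP; split=> // w _; rewrite /cylinder /=.
  exact: prefix_ext.
- exact: bigcup_const.
- rewrite GE => C [->|[w [n ->]]]; first by rewrite !measure0.
  exact: etrans (hP w n) (esym (hQ w n)).
- by move=> _; rewrite -ge0_fin_numE ?fin_num_measure.
Qed.

End run_probability_exists.

(* The choice is immaterial by [induced_unique]. *)
Definition run_prob (R : realType) (M : mdp) (sigma : strategy R M) (s : M) :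
  probability (runs s) R := sval (cid (induced_exists sigma s)).

Lemma run_probP (R : realType) (M : mdp) (sigma : strategy R M) (s : M) :
  induced_by sigma (run_prob sigma s).
Proof. exact: svalP (cid (induced_exists sigma s)). Qed.

Section dirac_distr.
Variables (R : realType) (T : countType) (A : pred T) (x : T).
Hypothesis Ax : A x.

Let mass (t : T) : R := (t == x)%:R.

Let mass_ge0 t : 0 <= mass t. Proof. exact: ler0n. Qed.

Let mass_out t : ~~ A t -> mass t = 0.
Proof. by rewrite /mass; case: eqP => // ->; rewrite Ax. Qed.

Let mass_sum1 : (\esum_(t in [set: T]) (mass t)%:E = 1)%E.
Proof.
transitivity (\esum_(t in [set x]) (mass t)%:E)%E.
  rewrite [RHS]esum_mkcond; apply: eq_esum => t _; rewrite /mass.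
  have [->|/eqP nx] := eqVneq t x; first by rewrite mem_set.
  by rewrite memNset.
by rewrite esum_set1 /mass ?eqxx// lee_fin.
Qed.

Definition dirac_distr : distr R A := Distr mass_ge0 mass_out mass_sum1.

End dirac_distr.

(* Deterministic finite-memory strategies. *)
Record dfm (M : mdp) := DFM {
  mode : finType;
  mode_init : mode;
  next_state : M -> mode -> M;
  next_mode : mode -> M -> M -> mode;
  next_state_trans : forall (t : M) (m : mode), trans t (next_state t m) }.

(* The mode reached from mode [m] after the path [t :: p]. *)
Fixpoint dfm_mode (M : mdp) (d : dfm M) (m : mode d) (t : M) (p : seq M) :
    mode d :=
  if p is t' :: p' then dfm_mode (next_mode m t t') t' p' else m.

Definition dfm_strategy (R : realType) (M : mdp) (d : dfm M) : strategy R M :=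
  fun h => dirac_distr R
    (next_state_trans (hist_last h)
       (dfm_mode (mode_init d) (val h).1 (val h).2)).

Definition rewards (R : realType) (M : mdp) (s : M) (w : run s) : nat -> \bar R :=
  fun n => (ratr (reward (w n) (w n.+1)) : R)%:E.

Definition limsup_ge0 (R : realType) (M : mdp) (s : M) : set (runs s) :=
  [set w | (0 <= limn_esup (rewards R w))%E].
Arguments limsup_ge0 R {M} s _.

Lemma measurable_limsup_ge0 (R : realType) (M : mdp) (s : M) :
  measurable (limsup_ge0 R s).
Proof.
pose f n (w : runs s) : \bar R := rewards R w n.
have mr n : measurable_fun setT (f n).
  move=> _ E mE; rewrite setTI.
  set F := fun h : history M =>
    if pselect (cylinder (s := s) h `<=` f n @^-1` E)
    then cylinder (s := s) h else set0.
  have -> : f n @^-1` E = \bigcup_(h in [set: history M]) F h.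
    apply/seteqP; split=> w; last first.
      by case=> h _; rewrite /F; case: pselect => // sub /sub.
    move=> wE; exists (run_prefix w n.+1) => //; rewrite /F.
    case: pselect => [?|nsub]; first by apply/cylinderP.
    exfalso; apply: nsub => v /cylinderP /prefixS[/(congr1 (@hist_last M)) e1 e2].
    by move: e1 wE; rewrite !hist_last_run_prefix /preimage /= /f /rewards => -> ; rewrite e2.
  apply: countable_bigcupT_measurable => [|h]; first exact: countableP.
  rewrite /F; case: pselect => [?|?]; last exact: measurable0.
  by apply: sub_sigma_algebra; exists h.
have := measurable_fun_limn_esup mr measurableT (emeasurable_itv `[0%E, +oo[).
rewrite setTI; congr measurable; apply/seteqP; split=> w.
  by rewrite /preimage /= in_itv /= andbT.
by rewrite /preimage /= in_itv /= andbT.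
Qed.

(* The state [0] is s_0 and, for [i >= 1], the state [i] is r_i, so that the
   transitions s_0 -> r_1 and r_i -> r_{i+1} both go from [i] to [i + 1]. *)
Definition ladder_trans (i j : nat) : bool :=
  (j == i.+1) || ((0 < i)%N && (j == 0%N)).

Definition ladder_reward (i j : nat) : rat :=
  if j == i.+1 then -1 else - i%:R^-1.

Lemma ladder_trans_total (i : nat) : exists j, ladder_trans i j.
Proof. by exists i.+1; rewrite /ladder_trans eqxx. Qed.

Definition ladder : mdp := @MDP nat ladder_trans ladder_reward ladder_trans_total.

Definition s_0 : ladder := 0%N.

Lemma ladder_finitely_branching : finitely_branching ladder.
Proof.
move=> i; apply: (@sub_finite_set _ _ [set` [:: i.+1; 0%N]]); last exact: finite_seq.
by move=> j /= /orP[/eqP->|/andP[_ /eqP->]]; rewrite !inE eqxx ?orbT.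
Qed.

Definition almost_surely_winning (R : realType) (M : mdp) (s : M)
    (phi : set (runs s)) : Prop :=
  exists sigma : strategy R M, run_prob sigma s phi = 1%E.
Arguments almost_surely_winning R {M s} phi.

(* Main.v *)
(** A strategy that never randomizes along some run induces the Dirac measure at
    that run.  For (1), follow the run that climbs to r_1, returns, climbs to
    r_2, returns, and so on: the returns earn -1, -1/2, -1/3, ...  For (2), the
    memory mode on arrival in s_0 determines the whole climb up to the next
    return, so finitely many modes give finitely many heights from which the
    run returns; if B bounds them, every reward is at most -1/(B + 1). *)

Require Import Defs.
From mathcomp Require Import all_boot all_order all_algebra.
From mathcomp Require Import all_classical all_reals all_analysis.
From mathcomp Require Import zify.

Set Implicit Arguments.
Unset Strict Implicit.
Unset Printing Implicit Defensive.
Import Order.TTheory GRing.Theory Num.Theory.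

Local Open Scope classical_set_scope.
Local Open Scope ring_scope.

(** Each tail supremum is at least [l - e] for every [e > 0], and the limsup is the limit of the
    tail suprema. *)
Lemma limn_esup_ge (R : realType) (u : (\bar R)^nat) (l : \bar R) :
  (forall (e : R) n, 0 < e -> exists2 k, (n <= k)%N & (l <= u k + e%:E)%E) ->
  (l <= limn_esup u)%E.
Proof.
move=> H; rewrite limn_esup_lim; apply: lime_ge; first exact: is_cvg_esups.
apply: nearW => n; apply/lee_addgt0Pr => e /(H e n)[k nk lk].
apply: (le_trans lk); rewrite leeD2r//.
by apply: ereal_sup_ubound; exists k.
Qed.

Lemma limn_esup_le (R : realType) (u : (\bar R)^nat) (l : \bar R) :
  (forall n, (u n <= l)%E) -> (limn_esup u <= l)%E.
Proof.
move=> H; rewrite limn_esup_lim; apply: lime_le; first exact: is_cvg_esups.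
by apply: nearW => n; apply: ge_ereal_sup => _ [k _ <-].
Qed.

Section deterministic.
Variables (R : realType) (M : mdp) (s : M).

(** Only the prefixes of [w] are constrained; off [w] the strategy is arbitrary. *)
Definition follows (sigma : strategy R M) (w : run s) :=
  forall n t, sigma (run_prefix w n) t = (t == w n.+1)%:R.

(** By uniqueness it suffices to compare cylinders: the product of probabilities stays 1 while [v]
    agrees with [w] and becomes 0 at the first disagreement. *)
Lemma follows_run_prob (sigma : strategy R M) (w : run s) (E : set (runs s)) :
  follows sigma w -> measurable E -> run_prob sigma s E = \d_(w : runs s) E.
Proof.
move=> sw; apply: induced_unique; first exact: run_probP.
move=> v n; rewrite [LHS]diracE; congr EFin.
have -> : ((w : runs s) \in cylinder (run_prefix v n)) =
          (run_prefix w n == run_prefix v n).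
  apply/idP/eqP => [|e]; first by rewrite inE => /cylinderP.
  by rewrite inE; apply/cylinderP.
elim: n => [|n IH].
  by rewrite big_ord0 (prefix_ext (w' := v)) ?eqxx.
rewrite big_ord_recr/= -IH; have [e|ne] := eqVneq (run_prefix w n) _.
  rewrite -e sw mul1r; congr (nat_of_bool _)%:R.
  by apply/eqP/eqP => [/prefixS[]//|?]; apply/prefixS.
rewrite mul0r; case: eqP => // /prefixS[e _].
by rewrite e eqxx in ne.
Qed.

Lemma follows_exists (w : run s) : exists sigma : strategy R M, follows sigma w.
Proof.
(* The length of a history tells how far along [w] it is; histories off [w] get an arbitrary
   successor. *)
pose c (h : history M) : M :=
  if run_prefix w (hist_length h) == h then w (hist_length h).+1
  else sval (default_succ (hist_last h)).
have ct h : trans (hist_last h) (c h).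
  rewrite /c; case: eqP => [{1}<-|_]; last exact: svalP (default_succ _).
  by rewrite hist_last_run_prefix; exact: run_trans.
exists (fun h => dirac_distr R (ct h)) => n t /=.
by rewrite /c /hist_length /= size_mkseq eqxx.
Qed.

End deterministic.

Section dfm_run.
Variables (M : mdp) (d : dfm M).

(** State and mode together evolve autonomously, so the current pair determines the whole future. *)
Definition dfm_step (x : M * mode d) : M * mode d :=
  let t := next_state x.1 x.2 in (t, next_mode x.2 x.1 t).

Definition dfm_run (s : M) (m : mode d) : run s :=
  @Run M s (fun n => (iter n dfm_step (s, m)).1) erefl
    (fun n => next_state_trans _ _).

(** [dfm_mode] recurses from the front of a path, whereas runs grow at the end. *)
Lemma dfm_mode_rcons m t p x :
  dfm_mode m t (rcons p x) = next_mode (dfm_mode m t p) (last t p) x :> mode d.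
Proof. by elim: p m t => //= y p IH m t; rewrite IH. Qed.

Lemma dfm_mode_run s (m : mode d) n (h := run_prefix (dfm_run s m) n) :
  dfm_mode m (val h).1 (val h).2 = (iter n dfm_step (s, m)).2.
Proof.
rewrite {}/h /=; elim: n => // n IH.
rewrite mkseqS dfm_mode_rcons IH.
by have := hist_last_run_prefix (dfm_run s m) n; rewrite /hist_last /= => ->.
Qed.

Lemma dfm_follows (R : realType) s :
  follows (dfm_strategy R d) (dfm_run s (mode_init d)).
Proof.
by move=> n t; rewrite /= dfm_mode_run hist_last_run_prefix.
Qed.

End dfm_run.

(* [(k, p)]: state [p] during the [k]-th climb, which goes up to [k + 1]. *)
Definition zigzag_step (x : nat * nat) : nat * nat :=
  if (x.2 <= x.1)%N then (x.1, x.2.+1) else (x.1.+1, 0%N).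

Definition zigzag n := iter n zigzag_step (0%N, 0%N).

Lemma zigzag_trans n : @trans ladder (zigzag n).2 (zigzag n.+1).2.
Proof.
rewrite /zigzag iterS -/(zigzag n); case: (zigzag n) => k p.
rewrite /zigzag_step /=; case: leqP => [_|kp]; apply/orP; first by left.
by right; rewrite (leq_ltn_trans _ kp).
Qed.

Definition zigzag_run : run s_0 :=
  @Run ladder s_0 (fun n => (zigzag n).2) erefl zigzag_trans.

Lemma zigzag_climb n k p :
  zigzag n = (k, 0%N) -> (p <= k.+1)%N -> zigzag (p + n) = (k, p).
Proof.
move=> nk; elim: p => // p IH pk.
by rewrite addSn /zigzag iterS -/(zigzag _) IH ?(ltnW pk)// /zigzag_step/= -ltnS pk.
Qed.

Lemma zigzag_peak k : exists2 n, (k <= n)%N & zigzag n = (k, k.+1).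
Proof.
suff [n kn e] : exists2 n, (k <= n)%N & zigzag n = (k, 0%N).
  exists (k.+1 + n)%N; first by rewrite (leq_trans kn)// leq_addl.
  exact: zigzag_climb.
elim: k => [|k [n kn e]]; first by exists 0%N.
(* [k.+1] steps up to the peak and one step back to [s_0]. *)
exists (k.+1 + n).+1; first by lia.
by rewrite /zigzag iterS -/(zigzag _) (zigzag_climb e)// /zigzag_step/= ltnn.
Qed.

Lemma zigzag_limsup (R : realType) : limsup_ge0 R s_0 zigzag_run.
Proof.
apply: limn_esup_ge => e n e0.
have [j je] : exists j : nat, j.+1%:R^-1 < e.
  exists (Num.truncn e^-1); rewrite invf_plt ?posrE//.
  by rewrite truncnS_gt.
(* [n] makes the peak late enough, [j] makes the return from it cost less than [e]. *)
pose k := maxn n j; have [m km zm] := zigzag_peak k.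
exists m; first by rewrite (leq_trans _ km)// leq_maxl.
have zmS : zigzag m.+1 = (k.+1, 0%N).
  by rewrite /zigzag iterS -/(zigzag m) zm /zigzag_step /= ltnn.
rewrite /rewards -[zigzag_run m]/(zigzag m).2 -[zigzag_run m.+1]/(zigzag m.+1).2.
rewrite zmS zm /= /ladder_reward /= -EFinD lee_fin rmorphN fmorphV /= ratr_nat.
rewrite addrC subr_ge0 (le_trans _ (ltW je))// lef_pV2 ?posrE//.
by rewrite ler_nat ltnS leq_maxr.
Qed.

Section ladder_dfm.
Variable d : dfm ladder.
Implicit Types m : mode d.
Local Notation F := (@dfm_step ladder d).

Definition resets_at m j :=
  (forall q, (q <= j)%N -> (iter q F (s_0, m)).1 = q) /\
  (iter j.+1 F (s_0, m)).1 = 0%N.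

(** If [j < i], the climb would be both at [j.+1] and at 0 after [j.+1] steps. By symmetry the
    return height is unique for each mode. *)
Lemma resets_at_le m i j : resets_at m i -> resets_at m j -> (i <= j)%N.
Proof.
move=> [up _] [_ zero]; rewrite leqNgt; apply/negP => /up.
by rewrite zero.
Qed.

Lemma resets_bounded : exists B, forall m j, resets_at m j -> (j <= B)%N.
Proof.
have /fin_all_exists[b bP] m : exists b, forall j, resets_at m j -> (j <= b)%N.
  have [[b mb]|no] := pselect (exists b, resets_at m b).
    by exists b => j mj; exact: resets_at_le mj mb.
  (* No return ever ends the climb from this mode, so any bound holds vacuously. *)
  by exists 0%N => j mj; case: no; exists j.
exists (\max_m b m) => m j /bP jb.
by rewrite (leq_trans jb)// leq_bigmax.
Qed.

(** Here [m] is the mode at the latest visit to [s_0] up to time [n]. Climbing gains one state per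
    step, so [x.1] is also the time elapsed since that visit. *)
Lemma dfm_last_climb m0 n (x := iter n F (s_0, m0)) : exists m,
  (forall q, (q <= x.1)%N -> (iter q F (s_0, m)).1 = q) /\
  iter x.1 F (s_0, m) = x.
Proof.
rewrite {}/x; elim: n => [|n [m [up e]]].
  by exists m0; split=> // q; rewrite leqn0 => /eqP ->.
rewrite iterS; set x := iter n _ _ in up e *.
have : ladder_trans x.1 (F x).1 by exact: (next_state_trans x.1 x.2).
case/orP => [/eqP ex|/andP[_ /eqP ex]].
  exists m; rewrite ex; split; last by rewrite iterS e.
  move=> q; rewrite leq_eqVlt => /orP[/eqP ->|/up//].
  by rewrite iterS e.
(* A return starts a new climb, in the mode just reached. *)
exists (F x).2; rewrite ex; split; last by rewrite [RHS]surjective_pairing ex.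
by move=> q; rewrite leqn0 => /eqP ->.
Qed.

Lemma dfm_not_limsup (R : realType) m : ~ limsup_ge0 R s_0 (dfm_run s_0 m).
Proof.
have [B BP] := resets_bounded.
(* The successor keeps the bound strictly negative even when [B] is 0. *)
suff H n : (rewards R (dfm_run s_0 m) n <= (- B.+1%:R^-1 : R)%:E)%E.
  rewrite /limsup_ge0 /= leNgt; apply/negP/negPn.
  apply: le_lt_trans (limn_esup_le H) _.
  by rewrite lte_fin oppr_lt0 invr_gt0.
have [m' [up e]] := dfm_last_climb m n.
rewrite /rewards lee_fin /= -[next_state _ _]/(F (iter n F (s_0, m))).1.
set x := iter n _ _ in up e *.
have : ladder_trans x.1 (F x).1 by exact: (next_state_trans x.1 x.2).
rewrite /ladder_trans /ladder_reward; case: eqP => [_ _|_ /andP[x0 /eqP ex]].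
  rewrite rmorphN rmorph1 lerN2 invf_le1 ?ltr0n//.
  by rewrite ler1n.
(* The climb from mode [m'] has reached [x] and returns now, so its height is one of those bounded
   by [B]. *)
have xB : (x.1 <= B)%N by apply: (BP m'); split=> //; rewrite iterS e.
rewrite rmorphN fmorphV /= ratr_nat lerN2 lef_pV2 ?posrE ?ltr0n//.
by rewrite ler_nat ltnW.
Qed.

End ladder_dfm.

Theorem proposition19 (R : realType) :
  [/\ almost_surely_winning R (limsup_ge0 R s_0),
      (forall d : dfm ladder,
         run_prob (dfm_strategy R d) s_0 (limsup_ge0 R s_0) = 0%E)
    & ~ (forall N : mdp, finitely_branching N ->
         forall s : N, almost_surely_winning R (limsup_ge0 R s) ->
         exists d : dfm N,
           run_prob (dfm_strategy R d) s (limsup_ge0 R s) = 1%E)].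
Proof.
have win : almost_surely_winning R (limsup_ge0 R s_0).
  have [sigma sw] := follows_exists R zigzag_run.
  exists sigma; rewrite (follows_run_prob sw); last exact: measurable_limsup_ge0.
  by rewrite diracE mem_set//; exact: zigzag_limsup.
have lose (d : dfm ladder) :
    run_prob (dfm_strategy R d) s_0 (limsup_ge0 R s_0) = 0%E.
  rewrite (follows_run_prob (dfm_follows d R s_0)); last exact: measurable_limsup_ge0.
  by rewrite diracE memNset//; exact: dfm_not_limsup.
split=> // /(_ ladder ladder_finitely_branching s_0 win)[d].
by rewrite lose => /esym/eqP; rewrite onee_eq0.
Qed.
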